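(* Let $m\ge 3$, $n\ge 1$, and let $A\in\mathbb{R}^{n\times n}$ be a symmetric matrix with zero diagonal. For $2\le k\le m$ and $1\le t\le b_{m,k}$, let ${\cal G}_{m,k,t}$ be a chosen representative of the $t$-th isomorphism class of self-loop-free induced FAMs of size $k$, let $d_{m,k,t}$ be the cardinality of that class, let $\sigma_{m,k,t}=\{S_1,\ldots,S_k\}$ be the partition inducing ${\cal G}_{m,k,t}$, and let $h_{m,k,t}=\prod_{i=1}^k(|S_i|-1)!$. Define $$\mu(\hat 0,\sigma_{m,k,t})=(-1)^{m-k}\,h_{m,k,t},\qquad a_{m,k,t}=d_{m,k,t}\cdot\mu(\hat 0,\sigma_{m,k,t}).$$ Then $$C_m=\sum_{k=2}^{m}\sum_{t=1}^{b_{m,k}}a_{m,k,t}\cdot \mathrm{FS}({\cal G}_{m,k,t}).$$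
   Context: Cycle count statistic: for a symmetric $A\in\mathbb{R}^{n\times n}$ with zero diagonal, $$C_m=\sum_{1\le i_1,\ldots,i_m\le n,\ \text{all distinct}}A_{i_1i_2}A_{i_2i_3}\cdots A_{i_mi_1}.$$ Root graph: let $S=\{i_1,\ldots,i_m\}$ be a set of $m$ distinct symbols, and let ${\cal G}$ be the $m$-cycle on node set $S$ with edges $i_1i_2,\ i_2i_3,\ \ldots,\ i_{m-1}i_m,\ i_mi_1$. Induced FAMs: for a partition $\sigma=\{S_1,\ldots,S_k\}$ of $S$ into $k$ non-empty blocks, the induced FAM (fully annotated multigraph) ${\cal G}_\sigma$ is the undirected multigraph with nodes $j_1,\ldots,j_k$ obtained from the $m$-cycle by merging the nodes of each block $S_\ell$ into the single node $j_\ell$ and keeping all $m$ edges (so parallel edges and self-loops may occur). Every node is labeled by the all-ones vector ${\bf 1}_n$ and every edge by the matrix $A$. The size of ${\cal G}_\sigma$ is $k$. Write $w(a,b)$ for the number of edges between $j_a$ and $j_b$. Full Sum: for a self-loop-free induced FAM ${\cal G}_\sigma$ of size $k$, $$\mathrm{FS}({\cal G}_\sigma)=\sum_{1\le j_1,\ldots,j_k\le n}\ \prod_{1\le a<b\le k}(A_{j_aj_b})^{w(a,b)},$$ where $x^0=1$ and the indices are not required to be distinct. Isomorphism classes: two induced FAMs are isomorphic if one is obtained from the other by a permutation of the nodes (preserving the edge multiplicities). Discard all induced FAMs having a self-loop. For $2\le k\le m$, partition the remaining FAMs ${\cal G}_\sigma$ with $|\sigma|=k$ into isomorphism classes; $b_{m,k}$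 is the number of classes, and $d_{m,k,t}$ is the cardinality of the $t$-th class, i.e. the number of partitions $\sigma$ of $S$ with ${\cal G}_\sigma$ in that class. The symbol $\hat 0$ denotes the finest partition (all blocks singletons). *)

(* Defs.v *)
From HB Require Import structures.
From mathcomp Require Import all_boot all_order all_algebra all_fingroup.
From mathcomp Require Import reals.
Set Implicit Arguments.
Unset Strict Implicit.
Unset Printing Implicit Defensive.
Import GRing.Theory.
Local Open Scope ring_scope.

Definition cycle_count (R : realType) (n m : nat) (A : 'M[R]_n) : R :=
  \sum_(f : {ffun 'I_m -> 'I_n} | injectiveb f)
    \prod_(i < m) A (f i) (f (ordS i)).

(* An undirected multigraph on the nodes 'I_k is its matrix of edge
   multiplicities, the diagonal counting self-loops.  The node labels (all
   equal to the all-ones vector) and the edge labels (all equal to A) are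
   constant, so they carry no data and are preserved by every isomorphism. *)
Definition multigraph (k : nat) := 'M[nat]_k.

Definition loopless (k : nat) (G : multigraph k) : bool :=
  [forall a, G a a == 0%N].

Definition mg_iso (k : nat) (G H : multigraph k) : bool :=
  [exists s : 'S_k, [forall a, forall b, H a b == G (s a) (s b)]].

(* The symbols of the root graph are the elements of 'I_m and its edges are
   indexed by i : 'I_m, edge i joining i to ordS i = i + 1 mod m. *)
Definition joins (m : nat) (B C : {set 'I_m}) (i : 'I_m) : bool :=
  (i \in B) && (ordS i \in C) || (i \in C) && (ordS i \in B).

(* Node a is the a-th block in the enumeration of sigma; this is only meaningful
   for k = #|sigma|. *)
Definition block (m k : nat) (sigma : {set {set 'I_m}}) (a : 'I_k) : {set 'I_m} :=
  nth set0 (enum sigma) a.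

Definition induced_fam (m k : nat) (sigma : {set {set 'I_m}}) : multigraph k :=
  \matrix_(a, b) #|[set i | joins (block sigma a) (block sigma b) i]|.

Definition full_sum (R : realType) (n k : nat) (A : 'M[R]_n)
    (G : multigraph k) : R :=
  \sum_(j : {ffun 'I_k -> 'I_n})
    \prod_(a < k) \prod_(b < k | (a < b)%N) A (j a) (j b) ^+ G a b.

Definition fam_partitions (m k : nat) : {set {set {set 'I_m}}} :=
  [set sigma | [&& partition sigma [set: 'I_m], #|sigma| == k
                 & loopless (induced_fam k sigma)]].

(* An isomorphism class of induced FAMs is represented by the set of the
   partitions inducing its members. *)
Definition fam_classes (m k : nat) : {set {set {set {set 'I_m}}}} :=
  equivalence_partition
    (fun sigma tau => mg_iso (induced_fam k sigma) (induced_fam k tau))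
    (fam_partitions m k).

Definition nb_classes (m k : nat) : nat := #|fam_classes m k|.

Definition fam_class (m k : nat) (t : 'I_(nb_classes m k)) :
    {set {set {set 'I_m}}} :=
  enum_val t.

Definition class_size (m k : nat) (t : 'I_(nb_classes m k)) : nat :=
  #|fam_class t|.

Definition hfact (m : nat) (sigma : {set {set 'I_m}}) : nat :=
  \prod_(B in sigma) (#|B| - 1)`!.

Definition mu0 (R : realType) (m k : nat) (sigma : {set {set 'I_m}}) : R :=
  (-1) ^+ (m - k) * (hfact sigma)%:R.

Definition fam_coef (R : realType) (m k : nat) (t : 'I_(nb_classes m k))
    (sigma : {set {set 'I_m}}) : R :=
  (class_size t)%:R * mu0 R k sigma.

(* Main.v *)
(* For f : 'I_m -> 'I_n, Moebius inversion on the partition lattice amounts to: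
   the sum of mu(0, P) over the partitions P of D with f constant on each block
   is 1 if f is injective on D and 0 otherwise.  It is proved by adding a point
   x to D: in a partition of D, x either becomes a new block, or joins a block B
   on which f takes the value f x, which multiplies the weight by - #|B|; the sum
   is thus multiplied by 1 - #|{y in D | f y = f x}|.
   Summed over f, this writes the cycle count as the sum over all partitions P of
   mu(0, P) times the cycle sum over the f constant on the blocks of P, which is
   the full sum of the induced FAM, or 0 if there is a self-loop.  Finally the
   full sum and mu are constant on isomorphism classes. *)
Require Import Defs.
From HB Require Import structures.
From mathcomp Require Import all_boot all_order all_algebra all_fingroup.
From mathcomp Require Import reals.
Set Implicit Arguments.
Unset Strict Implicit.
Unset Printing Implicit Defensive.
Import GRing.Theory.
Local Open Scope ring_scope.

(** * Moebius inversion on the partition lattice *)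

Section Moebius.
Variable T : finType.
Implicit Types (D B C : {set T}) (P Q : {set {set T}}) (x y : T).

Lemma partition_notin x D P B :
  x \notin D -> partition P D -> B \in P -> x \notin B.
Proof.
by move=> xD partP PB; apply: contraNN xD; apply/subsetP/(partitionS partP).
Qed.

(** The left side is the condition that [reindex_onto] leaves when the block [[set x]] is added,
    with its removal as inverse. *)
Lemma partition_add_singleton x D P : x \notin D ->
  [&& partition ([set x] |: P) (x |: D), [set x] \in [set x] |: P
    & ([set x] |: P) :\ [set x] == P] = partition P D.
Proof.
move=> xD; rewrite setU11 /=; apply/andP/idP => [[partP /eqP eqP]|partP].
  by have := partitionD1 partP (setU11 _ _); rewrite eqP setU1K.
rewrite partitionU1 ?disjoints1 //; last by apply/set0Pn; exists x; rewrite set11.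
rewrite setU1K //; apply/negP => Px.
by have := partition_notin xD partP Px; rewrite set11.
Qed.

(** The pair is a partition together with the block of it that is to receive [x]; [remove_point] is
    the inverse and remembers which block has lost [x]. *)
Definition insert_in_block x (p : {set {set T}} * {set T}) : {set {set T}} :=
  (x |: p.2) |: (p.1 :\ p.2).

Definition remove_point x P : {set {set T}} * {set T} :=
  let C := pblock P x in ((C :\ x) |: (P :\ C), C :\ x).

(** As [[set x]] is not a block, the shrunk block is non-empty. It lies inside [C], so it cannot be
    one of the other blocks, which are disjoint from [C]. Removing [x] therefore merges no blocks
    and can be undone. *)
Lemma pblock_remove_point x D P (C := pblock P x) :
    x \notin D -> partition P (x |: D) -> [set x] \notin P ->
  [/\ C \in P, x \in C, C :\ x != set0, C :\ x \notin P :\ C &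
      partition ((C :\ x) |: (P :\ C)) D].
Proof.
move=> xD partP Px.
have xP : x \in cover P by rewrite (cover_partition partP) setU11.
have PC : C \in P by apply: pblock_mem.
have xC : x \in C by rewrite mem_pblock.
have C0 : C :\ x != set0.
  by apply: contraNneq Px => C0; rewrite -(setD1K xC) C0 setU0 in PC.
have CD : C :\ x \subset D.
  by rewrite subDset; apply: partitionS PC.
have disC : [disjoint C :\ x & (x |: D) :\: C].
  by rewrite -setI_eq0; apply/eqP/setP => y; rewrite !inE; case: (y \in C); rewrite ?andbF.
have partQ := partitionU1 (partitionD1 partP PC) C0 disC.
split=> //; first apply/negP => /setD1P[neqC PCx].
  case/set0Pn: C0 => y yC; move/trivIsetP: (partition_trivIset partP) => tiP.
  have := tiP _ _ PCx PC neqC; rewrite disjoint_subset => /subsetP/(_ y yC).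
  by move: yC; rewrite !inE => /andP[_ ->].
rewrite (_ : D = C :\ x :|: (x |: D) :\: C) //.
apply/setP => y; rewrite !inE; have [->|/= neq_yx] := eqVneq y x.
  by rewrite (negPf xD) xC.
case yC: (y \in C) => //=; apply/(subsetP CD); rewrite !inE neq_yx; exact: yC.
Qed.

Lemma remove_pointK x D P :
    x \notin D -> partition P (x |: D) -> [set x] \notin P ->
  insert_in_block x (remove_point x P) = P.
Proof.
move=> xD partP Px.
have [PC xC C0 CxP _] := pblock_remove_point xD partP Px.
by rewrite /insert_in_block /= setD1K // setU1K // setD1K.
Qed.

Lemma partition_insert_in_block x D p (P := insert_in_block x p) :
    x \notin D ->
  [&& partition P (x |: D), [set x] \notin P & remove_point x P == p]
    = partition p.1 D && (p.2 \in p.1).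
Proof.
move=> xD; apply/and3P/andP => [[partP Px /eqP def_p]|[partp pB]].
  have [PC xC C0 CxP partQ] := pblock_remove_point xD partP Px.
  by rewrite -def_p setU11.
have xB := partition_notin xD partp pB.
have B0 := partition_neq0 partp pB.
have partP : partition P (x |: D).
  rewrite (_ : x |: D = (x |: p.2) :|: D :\: p.2).
    apply: partitionU1; first exact: partitionD1.
      by apply/set0Pn; exists x; rewrite setU11.
    rewrite -setI_eq0; apply/eqP/setP => y; rewrite !inE.
    by have [->|_] := eqVneq y x; rewrite ?(negPf xD) ?andbF //= andbA andbN.
  by rewrite -setUA setDE setUIr setUCr setIT (setUidPr (partitionS partp pB)).
have xBP : x |: p.2 \notin p.1 :\ p.2.
  apply/negP => /setD1P[_ /(partition_notin xD partp)].
  by rewrite setU11.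
split=> //.
  rewrite !inE negb_or; apply/andP; split.
    case/set0Pn: B0 => y yB; apply/eqP => /setP/(_ y); rewrite !inE yB orbT => /eqP xy.
    by rewrite -xy yB in xB.
  by apply/negP => /andP[_ /(partition_notin xD partp)]; rewrite set11.
rewrite /remove_point.
have -> : pblock P x = x |: p.2.
  by apply: def_pblock (partition_trivIset partP) _ _; rewrite setU11.
by rewrite setU1K // /P /insert_in_block setU1K // setD1K // -surjective_pairing.
Qed.

Lemma sum_partitionU1 (V : nmodType) x D (F : {set {set T}} -> V) : x \notin D ->
  \sum_(P | partition P (x |: D)) F P =
  \sum_(P | partition P D)
     (F ([set x] |: P) + \sum_(B in P) F ((x |: B) |: (P :\ B))).
Proof.
move=> xD; rewrite (bigID (fun P => [set x] \in P)) big_split /=; congr (_ + _).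
  rewrite (reindex_onto (fun P => [set x] |: P) (fun P => P :\ [set x])) /=.
    by apply: eq_bigl => P; rewrite -andbA partition_add_singleton.
  by move=> P /andP[_ Px]; rewrite setD1K.
rewrite pair_big_dep /=.
rewrite (reindex_onto (insert_in_block x) (remove_point x)) /=.
  by apply: eq_bigl => p; rewrite -andbA partition_insert_in_block.
by move=> P /andP[partP Px]; apply: remove_pointK partP Px.
Qed.

Variables (R : comNzRingType) (U : eqType) (f : T -> U).

Definition constant_on B := [forall y in B, forall z in B, f y == f z].

Lemma constant_onP B : reflect {in B &, forall y z, f y = f z} (constant_on B).
Proof.
apply: (iffP forall_inP) => cB y => [z By Bz | By].
  by apply/eqP; move/forall_inP: (cB y By); apply.
by apply/forall_inP => z Bz; apply/eqP/cB.
Qed.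

(** The product of these weights over the blocks of [P] is mu(0, P) if [f] is constant on every
    block, and 0 otherwise. *)
Definition block_weight B : R :=
  (constant_on B)%:R * ((-1) ^+ (#|B| - 1) * (#|B| - 1)`!%:R).

Lemma block_weight1 x : block_weight [set x] = 1.
Proof.
rewrite /block_weight cards1 !mulr1.
by case: constant_onP => // -[] y z /set1P-> /set1P->.
Qed.

(** If [f] is constant on [B], the counted set is all of [B] or empty, according to whether the
    constant is [f x]. Writing the factor as a count lets it be added up over the blocks of a
    partition. *)
Lemma block_weightU1 x B : x \notin B -> B != set0 ->
  block_weight (x |: B) = - #|[set y in B | f y == f x]|%:R * block_weight B.
Proof.
move=> xB B0; rewrite /block_weight cardsU1 xB add1n subn1 /=.
have B_gt0 : (0 < #|B|)%N by rewrite card_gt0.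
have cU1 : constant_on (x |: B) = constant_on B && [forall y in B, f y == f x].
  apply/constant_onP/andP => [cxB | [/constant_onP cB /forall_inP fx] y z].
    split; first by apply/constant_onP => y z yB zB; apply: cxB; apply: setU1r.
    by apply/forall_inP => y yB; apply/eqP/cxB; rewrite ?setU11 ?setU1r.
  case/setU1P => [->|yB] /setU1P[->|zB] //; last exact: cB.
    by rewrite (eqP (fx z zB)).
  by rewrite (eqP (fx y yB)).
rewrite {}cU1; have [cB|] := constant_onP B; last by rewrite !mul0r mulr0.
rewrite mul1r /=; case: forall_inP => [fx|nfx].
  have -> : [set y in B | f y == f x] = B.
    by apply/setP => y; rewrite inE; case yB: (y \in B) => //=; apply: fx.
  rewrite !mul1r; case: #|B| B_gt0 => // b _.
  by rewrite subn1 /= exprS factS natrM mulN1r !mulNr mulrCA.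
rewrite mul0r (_ : [set y in B | _] = set0) ?cards0 ?oppr0 ?mul0r //.
apply/setP => y; rewrite !inE; apply/negP => /andP[yB /eqP fy].
by apply: nfx => z zB; rewrite -fy; apply/eqP/cB.
Qed.

Lemma sum_block_weight D :
  \sum_(P | partition P D) \prod_(B in P) block_weight B
    = (dinjectiveb f D)%:R.
Proof.
move: {2}#|D| (erefl #|D|) => d; elim: d D => [|d IHd] D.
  move/eqP; rewrite cards_eq0 => /eqP->.
  under eq_bigl do rewrite partition_set0.
  rewrite big_pred1_eq big_set0 (_ : dinjectiveb f set0) //.
  by apply/dinjectiveP => x; rewrite inE.
move=> cardD; have /card_gt0P[x xD] : (0 < #|D|)%N by rewrite cardD.
move: cardD; rewrite -(setD1K xD); set E := D :\ x.
have xE : x \notin E by rewrite !inE eqxx.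
rewrite cardsU1 xE add1n => -[cardE]; rewrite sum_partitionU1 //.
transitivity (\sum_(P | partition P E)
    (1 - #|[set y in E | f y == f x]|%:R) * \prod_(B in P) block_weight B).
  apply: eq_bigr => P partP.
  have xP B : B \in P -> x \notin B by apply: partition_notin partP.
  rewrite big_setU1 /=; last by apply/negP => /xP; rewrite set11.
  rewrite block_weight1 mulrBl !mul1r; congr (_ + _).
  (* The points of [E] with value [f x] are counted block by block; the share of [B] is the factor
     gained when [x] joins [B]. *)
  rewrite -mulNr -sum1_card (eq_bigl (fun y => (y \in E) && (f y == f x))); last first.
    by move=> y; rewrite inE.
  rewrite (set_partition_big_cond _ partP) natr_sum -sumrN mulr_suml.
  apply: eq_bigr => B PB; rewrite big_setU1 /=; last first.
    by apply/negP => /setD1P[_ /xP]; rewrite setU11.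
  rewrite block_weightU1 ?xP ?(partition_neq0 partP PB) //.
  rewrite -mulrA [in RHS](big_setD1 B) //=; congr (- _%:R * _).
  by rewrite -sum1_card; apply: eq_bigl => y; rewrite inE.
rewrite -mulr_sumr IHd //; case: (dinjectiveP f E) => injE; last first.
  rewrite mulr0; case: dinjectiveP => // injD; case: injE.
  by move=> y z yE zE; apply: injD; apply: setU1r.
(* As [f] is injective on [E], at most one point of [E] has value [f x], so the factor is 1 or 0. *)
rewrite mulr1; have [ex|] := set_0Vmem [set y in E | f y == f x].
  rewrite ex cards0 subr0; case: dinjectiveP => // -[] y z.
  have fE u : u \in E -> f u <> f x.
    by move=> uE fu; move/setP/(_ u): ex; rewrite !inE -in_setD1 uE fu eqxx.
  by case/setU1P => [->|yE] /setU1P[->|zE] //;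
    [move/esym/(fE z zE) | move/(fE y yE) | apply: injE].
case=> y; rewrite !inE -in_setD1 => /andP[yE /eqP fy].
rewrite (_ : [set y in E | _] = [set y]); last first.
  apply/setP => z; rewrite !inE -in_setD1; apply/andP/eqP => [[zE /eqP fz]|->].
    by apply: injE => //; rewrite fz.
  by rewrite yE fy.
rewrite cards1 subrr; case: dinjectiveP => // injD.
have xy : y = x by apply: injD; rewrite ?setU11 ?setU1r.
by rewrite -xy yE in xE.
Qed.

End Moebius.

(** * Numbering the blocks of a partition *)

Section Blocks.
Variables (m k : nat) (sigma : {set {set 'I_m}}).
Hypothesis part : partition sigma [set: 'I_m].
Hypothesis cardk : #|sigma| = k.

(** [idx] numbers the block of a symbol and [rep] picks a symbol in each block. Since [sigma] has
    exactly [k] blocks, the default [set0] in [block] is never reached. *)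
Lemma block_index :
  {idx : 'I_m -> 'I_k & {rep : 'I_k -> 'I_m | cancel rep idx
    & forall i a, (i \in block sigma a) = (idx i == a)}}.
Proof.
have szk : size (enum sigma) = k by rewrite -cardE.
have Pin i : pblock sigma i \in enum sigma.
  by rewrite mem_enum pblock_mem // (cover_partition part) inE.
have ltk i : (index (pblock sigma i) (enum sigma) < k)%N.
  by rewrite -[X in (_ < X)%N]szk index_mem.
have blk (a : 'I_k) : block sigma a \in sigma.
  by rewrite -mem_enum mem_nth // szk ltn_ord.
have idxE i (a : 'I_k) : (i \in block sigma a) = (Ordinal (ltk i) == a).
  apply/idP/eqP => [ia|<-].
    apply/val_inj => /=; rewrite (def_pblock (partition_trivIset part) (blk a) ia).
    by rewrite index_uniq ?enum_uniq // szk.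
  rewrite /block /= nth_index ?Pin //.
  by rewrite mem_pblock (cover_partition part) inE.
exists (fun i => Ordinal (ltk i)).
have nempty (a : 'I_k) : exists i, i \in block sigma a.
  by apply/set0Pn; apply: partition_neq0 part (blk a).
exists (fun a => xchoose (nempty a)) => // a /=.
by apply/eqP; rewrite -idxE; apply: xchooseP.
Qed.

Lemma big_block (R : Type) (idx : R) (op : Monoid.com_law idx) (F : {set 'I_m} -> R) :
  \big[op/idx]_(B in sigma) F B = \big[op/idx]_(a < k) F (block sigma a).
Proof.
rewrite -big_enum (big_nth set0) big_mkord -cardE cardk.
by apply: eq_bigr.
Qed.

End Blocks.

(** * Unordered pairs of distinct nodes, coded as increasing pairs *)

Definition sort_pair (k : nat) (p : 'I_k * 'I_k) : 'I_k * 'I_k :=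
  if (p.1 < p.2)%N then p else (p.2, p.1).

Lemma sort_pair_lt (k : nat) (p : 'I_k * 'I_k) :
  p.1 != p.2 -> ((sort_pair p).1 < (sort_pair p).2)%N.
Proof.
by rewrite /sort_pair -val_eqE neq_ltn => /=; case: ifP => //= ->.
Qed.

Lemma sort_pairE (k : nat) (a b c d : 'I_k) : (a < b)%N -> c != d ->
  (sort_pair (c, d) == (a, b)) = (c == a) && (d == b) || (c == b) && (d == a).
Proof.
move=> ab; rewrite -val_eqE neq_ltn /sort_pair /=.
case: ltnP => /= [cd _|_ dc]; rewrite xpair_eqE.
  rewrite orb_idr // => /andP[/eqP cb /eqP da].
  by move: cd; rewrite cb da ltnNge (ltnW ab).
rewrite orb_idl 1?andbC // => /andP[/eqP ca /eqP db].
by move: dc; rewrite ca db ltnNge (ltnW ab).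
Qed.

(** A permutation of the nodes permutes the unordered pairs: [h s] is this action on increasing
    pairs, and the symmetry of [F] absorbs the swaps made by sorting. *)
Lemma prod_sort_perm (R : comNzRingType) (k : nat) (F : 'I_k -> 'I_k -> R)
    (s : 'S_k) : (forall a b, F a b = F b a) ->
  \prod_(a < k) \prod_(b < k | (a < b)%N) F (s a) (s b)
    = \prod_(a < k) \prod_(b < k | (a < b)%N) F a b.
Proof.
move=> symF; rewrite !pair_big_dep /=.
pose h (u : 'S_k) (p : 'I_k * 'I_k) := sort_pair (u p.1, u p.2).
have hK (u : 'S_k) (p : 'I_k * 'I_k) : (p.1 < p.2)%N -> h u^-1%g (h u p) = p.
  case: p => a b /= ab; rewrite /h /sort_pair /=.
  case: (ltnP (u a) (u b)) => _ /=; rewrite !permK ?ab //.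
  by rewrite ltnNge (ltnW ab).
have h_lt (u : 'S_k) (p : 'I_k * 'I_k) : (p.1 < p.2)%N -> ((h u p).1 < (h u p).2)%N.
  move=> ltp; apply: sort_pair_lt => /=; rewrite (inj_eq perm_inj).
  by rewrite -val_eqE neq_ltn ltp.
rewrite [RHS](reindex_onto (h s) (h s^-1%g)) /=; last first.
  by move=> p /(hK s^-1%g); rewrite invgK.
apply: eq_big => [p|p _]; last by rewrite /h /sort_pair /=; case: ifP => //=.
apply/idP/andP => [ltp | [/(h_lt s^-1%g) + /eqP hp]]; last by rewrite hp.
by rewrite h_lt // hK.
Qed.

(** * Degrees and full sums of induced FAMs *)

Section InducedFam.
Variables (m k : nat) (sigma : {set {set 'I_m}}).
Variables (idx : 'I_m -> 'I_k) (rep : 'I_k -> 'I_m).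
Hypothesis repK : cancel rep idx.
Hypothesis idxE : forall i a, (i \in block sigma a) = (idx i == a).

Let G : multigraph k := induced_fam k sigma.

Lemma induced_famE a b :
  G a b = #|[set i | (idx i == a) && (idx (ordS i) == b)
                  || (idx i == b) && (idx (ordS i) == a)]|.
Proof. by rewrite mxE; apply: eq_card => i; rewrite !inE /joins !idxE. Qed.

Lemma induced_fam_sym a b : G a b = G b a.
Proof. by rewrite !induced_famE; apply: eq_card => i; rewrite !inE orbC. Qed.

Lemma looplessP : reflect (forall i, idx i != idx (ordS i)) (loopless G).
Proof.
apply: (iffP forallP) => [loopG i | neq a].
  apply/negP => /eqP eq_i; have := loopG (idx i).
  rewrite induced_famE cards_eq0 => /eqP/setP/(_ i).
  by rewrite !inE -eq_i !eqxx.
rewrite induced_famE cards_eq0; apply/eqP/setP => i; rewrite !inE orbb.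
by apply/negP => /andP[/eqP ia /eqP Sia]; move: (neq i); rewrite ia Sia eqxx.
Qed.

(** Each symbol of the block is an end of two edge positions of the cycle, [i] and its predecessor;
    without self-loops, no edge has both ends in the block. *)
Lemma degree_induced_fam a :
  loopless G -> (\sum_b G a b = #|block sigma a|.*2)%N.
Proof.
move/looplessP => neq.
transitivity (\sum_i ((idx i == a) + (idx (ordS i) == a)))%N.
  (* The two orientations of an edge exclude each other when there is no self-loop, so the indicator
     of their disjunction is the sum of two products. *)
  transitivity (\sum_b \sum_i
      ((idx i == a) * (idx (ordS i) == b) + (idx (ordS i) == a) * (idx i == b)))%N.
    apply: eq_bigr => b _; rewrite induced_famE -sum1_card big_mkcond /=.
    apply: eq_bigr => i _; rewrite inE.
    have disj c : (idx i == c) && (idx (ordS i) == c) = false.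
      by apply/negP => /andP[/eqP ic /eqP Sic]; move: (neq i); rewrite ic Sic eqxx.
    move: (disj a) (disj b).
    by case: (idx i == a); case: (idx i == b); case: (_ == a); case: (_ == b).
  rewrite exchange_big /=; apply: eq_bigr => i _.
  have sum1 (c : 'I_k) : (\sum_b (c == b) = 1)%N.
    by rewrite (bigD1 c) //= eqxx big1 // => b; rewrite eq_sym => /negPf->.
  by rewrite big_split /= -!big_distrr /= !sum1 !muln1.
have cardE : (\sum_i (idx i == a) = #|block sigma a|)%N.
  rewrite -sum1_card big_mkcond [RHS]big_mkcond /=.
  by apply: eq_bigr => i _; rewrite idxE; case: eqP.
rewrite big_split /= -addnn; congr (_ + _)%N => //.
by rewrite -cardE [RHS](reindex_inj (can_inj (@ordSK m))).
Qed.

Variables (R : realType) (n : nat) (A : 'M[R]_n).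

(** A function constant on the blocks factors uniquely through [idx]; composing it with [rep]
    recovers the factor. *)
Lemma sum_constant_on_blocks (P : {ffun 'I_m -> 'I_n} -> R) :
  \sum_(f : {ffun 'I_m -> 'I_n}
        | [forall a : 'I_k, constant_on f (block sigma a)]) P f
    = \sum_(j : {ffun 'I_k -> 'I_n}) P [ffun i => j (idx i)].
Proof.
rewrite (reindex_onto (fun j : {ffun 'I_k -> 'I_n} => [ffun i => j (idx i)])
  (fun f : {ffun 'I_m -> 'I_n} => [ffun a => f (rep a)])) /=.
  apply: eq_bigl => j; apply/andP; split.
    apply/forallP => a; apply/constant_onP => y z; rewrite !idxE !ffunE.
    by move=> /eqP-> /eqP->.
  by apply/eqP/ffunP => a; rewrite !ffunE repK.
move=> f /forallP cf; apply/ffunP => i; rewrite !ffunE.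
by have /constant_onP := cf (idx i); apply; rewrite idxE ?repK.
Qed.

Hypothesis Asym : A^T = A.

(** The edges of the cycle are grouped by the unordered pair of blocks they join. The size of a
    group is the multiplicity of that pair, and the symmetry of [A] makes the orientation
    irrelevant. *)
Lemma full_sum_induced_fam : loopless G ->
  full_sum A G = \sum_(j : {ffun 'I_k -> 'I_n})
    \prod_(i < m) A (j (idx i)) (j (idx (ordS i))).
Proof.
move/looplessP => neq; apply: eq_bigr => j _.
rewrite pair_big_dep /=.
rewrite [RHS](partition_big (fun i => sort_pair (idx i, idx (ordS i)))
  (fun p => (p.1 < p.2)%N)) /=; last first.
  by move=> i _; rewrite sort_pair_lt //= neq.
apply: eq_bigr => -[a b] /= ab.
transitivity (\prod_(i < m | sort_pair (idx i, idx (ordS i)) == (a, b)) A (j a) (j b)).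
  rewrite prodr_const induced_famE; congr (_ ^+ _); apply: eq_card => i.
  by rewrite !inE; apply/esym/sort_pairE.
apply: eq_bigr => i; rewrite sort_pairE // => /orP[] /andP[/eqP-> /eqP->] //.
by rewrite -[in LHS]Asym mxE.
Qed.

Hypothesis Adiag : forall i, A i i = 0.

Lemma sum_loop0 : ~~ loopless G ->
  \sum_(j : {ffun 'I_k -> 'I_n})
    \prod_(i < m) A (j (idx i)) (j (idx (ordS i))) = 0.
Proof.
move/looplessP => loop; apply: big1 => j _; apply/eqP.
apply/negP => /negP /prodf_neq0 nz; apply: loop => i.
by apply/eqP => eq_i; have := nz i isT; rewrite -eq_i Adiag eqxx.
Qed.

End InducedFam.

(** * Isomorphism of multigraphs *)

Lemma mg_isoP (k : nat) (G H : multigraph k) :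
  reflect (exists s : 'S_k, forall a b, H a b = G (s a) (s b)) (mg_iso G H).
Proof.
apply: (iffP existsP) => -[s Hs]; exists s.
  by move=> a b; apply/eqP; move/forallP/(_ a)/forallP: Hs; apply.
by apply/forallP => a; apply/forallP => b; apply/eqP.
Qed.

Lemma mg_iso_equivalence (k : nat) : equivalence_rel (@mg_iso k).
Proof.
have symG (G H : multigraph k) : mg_iso G H -> mg_iso H G.
  move=> /mg_isoP[s GH]; apply/mg_isoP; exists s^-1%g => a b.
  by rewrite GH !permKV.
have transG (G H K : multigraph k) : mg_iso G H -> mg_iso H K -> mg_iso G K.
  move=> /mg_isoP[s GH] /mg_isoP[u HK]; apply/mg_isoP; exists (u * s)%g => a b.
  by rewrite HK GH !permM.
move=> G H K; split; first by apply/mg_isoP; exists 1%g => a b; rewrite !perm1.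
move=> GH; apply/idP/idP; first exact: transG (symG _ _ GH).
exact: transG GH.
Qed.

(** The node indices are relabeled by the isomorphism. This does not preserve the order [a < b] in
    the product, which is repaired by [prod_sort_perm] and the symmetry of [G] and [A]. *)
Lemma full_sum_iso (R : realType) (n k : nat) (A : 'M[R]_n) (G H : multigraph k) :
    A^T = A -> (forall a b, G a b = G b a) -> mg_iso G H ->
  full_sum A H = full_sum A G.
Proof.
move=> Asym symG /mg_isoP[s GH]; rewrite /full_sum.
pose act (u : 'S_k) (j : {ffun 'I_k -> 'I_n}) : {ffun 'I_k -> 'I_n} := [ffun a => j (u a)].
have actK : cancel (act s^-1%g) (act s).
  by move=> j; apply/ffunP => a; rewrite !ffunE permK.
rewrite (reindex_inj (h := act s)) /=; last first.
  by apply: (can_inj (g := act s^-1%g)) => j; apply/ffunP => a; rewrite !ffunE permKV.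
apply: eq_bigr => j _.
rewrite -[RHS](prod_sort_perm (F := fun a b => A (j a) (j b) ^+ G a b) s); last first.
  by move=> a b; rewrite symG -[in LHS]Asym mxE.
by apply: eq_bigr => a _; apply: eq_bigr => b _; rewrite !ffunE GH.
Qed.

(** * Sums over isomorphism classes and over partitions *)

Section FamPartitions.
Variables (m k : nat).
Implicit Type sigma : {set {set 'I_m}}.

Lemma fam_partitionsP sigma : sigma \in fam_partitions m k ->
  [/\ partition sigma [set: 'I_m], #|sigma| = k & loopless (induced_fam k sigma)].
Proof. by rewrite inE => /and3P[? /eqP]. Qed.

Lemma hfact_block sigma : #|sigma| = k ->
  hfact sigma = (\prod_(a < k) (#|block sigma a| - 1)`!)%N.
Proof. by move=> cardk; rewrite /hfact (big_block cardk). Qed.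

(* In a loopless induced FAM the degree of a node is twice the size of its
   block, so an isomorphism preserves the block sizes. *)
Lemma hfact_iso sigma tau :
    sigma \in fam_partitions m k -> tau \in fam_partitions m k ->
  mg_iso (induced_fam k sigma) (induced_fam k tau) -> hfact tau = hfact sigma.
Proof.
move=> /fam_partitionsP[ps cs ls] /fam_partitionsP[pt ct lt] /mg_isoP[s GH].
rewrite (hfact_block cs) (hfact_block ct).
rewrite [RHS](reindex_inj (@perm_inj _ s)) /=; apply: eq_bigr => a _.
have [idx [rep _ idxE]] := block_index ps cs.
have [idx' [rep' _ idxE']] := block_index pt ct.
congr (_ - 1)`!; apply: double_inj.
rewrite -(degree_induced_fam idxE) // -(degree_induced_fam idxE') //.
by rewrite [RHS](reindex_inj (@perm_inj _ s)); apply: eq_bigr => b _; rewrite GH.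
Qed.

(** The ends of one edge lie in two different blocks, and [rep] injects the blocks into the
    symbols. *)
Lemma fam_partitions_bound sigma : (0 < m)%N ->
  sigma \in fam_partitions m k -> (2 <= k <= m)%N.
Proof.
move=> m_gt0 /fam_partitionsP[ps cs].
have [idx [rep repK idxE]] := block_index ps cs.
move/(looplessP idxE)/(_ (Ordinal m_gt0)); set i := Ordinal _ => neq; apply/andP; split.
  have := ltn_ord (idx i); move: (idx i) (idx (ordS i)) neq; clear.
  by case: k => [|[|l]] // a b; rewrite !ord1 eqxx.
by have := leq_card _ (can_inj repK); rewrite !card_ord.
Qed.

Variables (R : realType) (n : nat) (A : 'M[R]_n).
Hypothesis Asym : A^T = A.

(** Both [mu0] and the full sum are constant on a class, so the factor [class_size] replaces the sum
    over its members. *)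
Lemma sum_fam_classes (sigma : 'I_(nb_classes m k) -> {set {set 'I_m}}) :
    (forall t, sigma t \in fam_class t) ->
  \sum_(t < nb_classes m k)
     fam_coef R t (sigma t) * full_sum A (induced_fam k (sigma t))
    = \sum_(tau in fam_partitions m k)
        mu0 R k tau * full_sum A (induced_fam k tau).
Proof.
move=> sigma_t.
have eqR : {in fam_partitions m k & &, equivalence_rel
    (fun sigma tau => mg_iso (induced_fam k sigma) (induced_fam k tau))}.
  by move=> x y z _ _ _; apply: mg_iso_equivalence.
have partC := equivalence_partitionP eqR.
rewrite (set_partition_big _ partC) /= [RHS]big_enum_val /=.
apply: eq_bigr => t _; have Ct : fam_class t \in fam_classes m k by apply: enum_valP.
have subC := subsetP (partitionS partC Ct).
transitivity (\sum_(tau in fam_class t)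
    mu0 R k (sigma t) * full_sum A (induced_fam k (sigma t))).
  by rewrite sumr_const /fam_coef /class_size -[RHS]mulr_natl mulrA.
apply: eq_bigr => tau tau_t.
have iso : mg_iso (induced_fam k (sigma t)) (induced_fam k tau).
  rewrite -(pblock_equivalence_partition eqR) ?subC ?sigma_t //.
  by rewrite (def_pblock (partition_trivIset partC) Ct (sigma_t t)).
rewrite /mu0 (hfact_iso _ _ iso) ?subC ?sigma_t // (full_sum_iso Asym _ iso) //.
have [ps cs _] := fam_partitionsP (subC _ (sigma_t t)).
have [idx [rep _ idxE]] := block_index ps cs.
exact: induced_fam_sym.
Qed.

Lemma prod_mu0 sigma : partition sigma [set: 'I_m] -> #|sigma| = k ->
  \prod_(B in sigma) ((-1) ^+ (#|B| - 1) * (#|B| - 1)`!%:R) = mu0 R k sigma.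
Proof.
move=> ps cs; rewrite big_split /= -natr_prod prodrXr; congr (_ ^+ _ * _).
(* The truncated subtractions can be summed separately because blocks are non-empty; the exponent
   becomes [m - k]. *)
rewrite sumnB => [|B sB]; last by rewrite card_gt0 (partition_neq0 ps sB).
by rewrite -(card_partition ps) cardsT card_ord sum1_card cs.
Qed.

Hypothesis Adiag : forall i, A i i = 0.

(** The weights keep only the [f] constant on every block, that is, the assignments of indices to
    nodes. A self-loop then puts a diagonal entry of [A] into each product. *)
Lemma sum_block_weight_cycle sigma :
    partition sigma [set: 'I_m] -> #|sigma| = k ->
  \sum_(f : {ffun 'I_m -> 'I_n})
     (\prod_(B in sigma) block_weight R f B) * \prod_(i < m) A (f i) (f (ordS i))
    = (loopless (induced_fam k sigma))%:R
      * (mu0 R k sigma * full_sum A (induced_fam k sigma)).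
Proof.
move=> ps cs; have [idx [rep repK idxE]] := block_index ps cs.
transitivity (mu0 R k sigma * \sum_(j : {ffun 'I_k -> 'I_n})
    \prod_(i < m) A (j (idx i)) (j (idx (ordS i)))).
  transitivity (mu0 R k sigma * \sum_(j : {ffun 'I_k -> 'I_n})
      let f := [ffun i => j (idx i)] in \prod_(i < m) A (f i) (f (ordS i))); last first.
    by congr (_ * _); apply: eq_bigr => j _; apply: eq_bigr => i _; rewrite !ffunE.
  rewrite -(sum_constant_on_blocks repK idxE
    (fun f => \prod_(i < m) A (f i) (f (ordS i)))).
  rewrite [in RHS]big_mkcond mulr_sumr; apply: eq_bigr => f _.
  rewrite big_split /= (big_block cs _ (fun B => (constant_on f B)%:R)).
  case: forallP => [cf | ncf].
    rewrite big1 ?mul1r; last by move=> a _; rewrite cf.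
    by rewrite prod_mu0.
  rewrite mulr0; have /forallPn[a /negPf nca] := introN forallP ncf.
  by rewrite (bigD1 a) //= nca !mul0r.
have [loopG | loopG] := boolP (loopless _).
  by rewrite mul1r (full_sum_induced_fam idxE).
by rewrite mul0r (sum_loop0 idxE) // mulr0.
Qed.

End FamPartitions.

(** * The cycle count as a sum over partitions, sorted by size and class *)

Theorem theorem1 (R : realType) (m n : nat) (hm : (3 <= m)%N) (hn : (1 <= n)%N)
    (A : 'M[R]_n) (Asym : A^T = A) (Adiag : forall i, A i i = 0)
    (sigma : forall k : nat, 'I_(nb_classes m k) -> {set {set 'I_m}})
    (hsigma : forall (k : nat) (t : 'I_(nb_classes m k)),
       (2 <= k <= m)%N -> sigma k t \in fam_class t) :
  cycle_count m A =
    \sum_(2 <= k < m.+1) \sum_(t < nb_classes m k)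
      fam_coef R t (sigma k t) * full_sum A (induced_fam k (sigma k t)).
Proof.
have m_gt0 : (0 < m)%N by apply: leq_trans hm.
pose X k (tau : {set {set 'I_m}}) := mu0 R k tau * full_sum A (induced_fam k tau).
transitivity (\sum_(2 <= k < m.+1) \sum_(tau in fam_partitions m k) X k tau); last first.
  by apply: eq_big_nat => k km; rewrite sum_fam_classes // => t; apply: hsigma.
(* Taking [#|tau|] for [k] gives a single sum over partitions of all sizes; the boolean factor
   discards those with a self-loop. *)
transitivity (\sum_(tau | partition tau [set: 'I_m])
    (loopless (induced_fam #|tau| tau))%:R * X #|tau| tau).
  rewrite /cycle_count big_mkcond /=.
  transitivity (\sum_(f : {ffun 'I_m -> 'I_n})
      \sum_(tau | partition tau [set: 'I_m])
        (\prod_(B in tau) block_weight R f B) * \prod_(i < m) A (f i) (f (ordS i))).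
    apply: eq_bigr => f _; rewrite -mulr_suml sum_block_weight.
    have -> : dinjectiveb f [set: 'I_m] = injectiveb f.
      apply/dinjectiveP/injectiveP => injf x y; last by move=> _ _; apply: injf.
      by apply: injf; rewrite inE.
    by case: injectiveb; rewrite ?mul1r ?mul0r.
  rewrite exchange_big /=; apply: eq_bigr => tau partt.
  exact: sum_block_weight_cycle.
(* With the sum over [tau] outside, a loopless [tau] contributes only at [k = #|tau|], which lies in
   the range of summation by [fam_partitions_bound]. *)
rewrite (exchange_big_dep (fun tau => partition tau [set: 'I_m])) /=; last first.
  by move=> k tau _ /fam_partitionsP[].
apply: eq_bigr => tau partt; case: (boolP (loopless _)) => loopt; last first.
  rewrite mul0r big1 // => k /fam_partitionsP[_ ck lk].
  by rewrite -ck in lk; rewrite lk in loopt.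
have tauk : tau \in fam_partitions m #|tau| by rewrite inE partt eqxx.
rewrite mul1r big_mkcond (bigD1_seq #|tau|) ?iota_uniq //=; last first.
  by rewrite mem_index_iota; apply: fam_partitions_bound tauk.
rewrite tauk big1 ?addr0 // => k /negPf neq_k; case: ifP => // /fam_partitionsP[_ ck _].
by rewrite ck eqxx in neq_k.
Qed.
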